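(* Let $\lambda>0$, let $K\subset\mathbb{R}^n\times\mathbb{R}^m$ be a closed convex set, let $f$ be a finite DC function on $\mathbb{R}^n\times\mathbb{R}^m$, and let $\{r_\theta\}_{\theta>0}$ be an admissible family of approximations of the step function (as defined in the context). Let $\mathcal{P}$ be the set of global solutions of $$\min\{f(x,y)+\lambda\|x\|_0 : (x,y)\in K\},$$ and for $\theta>0$ let $\mathcal{P}_\theta$ be the set of global solutions of $$\min\Big\{f(x,y)+\lambda\sum_{i=1}^n r_\theta(x_i) : (x,y)\in K\Big\}.$$ Then: (i) Let $\{\theta_k\}$ be a sequence of positive numbers with $\theta_k\to+\infty$ and let $\{(x^k,y^k)\}$ be a sequence such that $(x^k,y^k)\in\mathcal{P}_{\theta_k}$ for every $k$. If $(x^k,y^k)\to(x^*,y^* )$, then $(x^*,y^* )\in\mathcal{P}$. (ii) If $K$ is compact, then for every $\epsilon>0$ there is $\theta(\epsilon)>0$ such that $\mathcal{P}_\theta\subset\mathcal{P}+B(0,\epsilon)$ for all $\theta\ge\theta(\epsilon)$. (iii) If there is a finite set $\mathcal{S}\subset\mathbb{R}^n\times\mathbb{R}^m$ such that $\mathcal{P}_\theta\cap\mathcal{S}\neq\emptyset$ for all $\theta>0$, then there exists $\theta_0\ge 0$ such that $\mathcal{P}_\theta\cap\mathcal{S}\subset\mathcal{P}$ for all $\theta>0$ with $\theta\ge\theta_0$.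
   Context: $\|x\|_0$ is the number of nonzero components of $x\in\mathbb{R}^n$. $B(0,\epsilon)$ is the open Euclidean ball of radius $\epsilon$ centered at $0$. The function $s:\mathbb{R}\to\mathbb{R}$ is $s(t)=1$ if $t\ne0$ and $s(0)=0$. A finite DC function is a function $f=g-h$ with $g,h$ finite convex functions on the whole space. A family $\{r_\theta\}_{\theta>0}$ of functions $\mathbb{R}\to\mathbb{R}$ is called admissible if: (1) $\lim_{\theta\to+\infty}r_\theta(t)=s(t)$ for all $t\in\mathbb{R}$; (2) for every $\theta>0$, $r_\theta$ is even, i.e. $r_\theta(t)=r_\theta(|t|)$, and increasing (meaning nondecreasing) on $[0,+\infty)$; (3) for every $\theta>0$, $r_\theta=\varphi_\theta-\psi_\theta$ with given finite convex functions $\varphi_\theta,\psi_\theta$ on $\mathbb{R}$; write $\partial r_\theta(t):=\{u-v:u\in\partial\varphi_\theta(t),\,v\in\partial\psi_\theta(t)\}$, where $\partial$ of a convex function is its convex subdifferential; (4) $t\mu\ge0$ for all $\theta>0$, $t\in\mathbb{R}$, $\mu\in\partial r_\theta(t)$; (5) for any $a\le b$ with $0\notin[a,b]$, $\lim_{\theta\to+\infty}\sup\{|z|:z\in\partial r_\theta(t),\,t\in[a,b]\}=0$. *)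

(* Defs.v *)
From mathcomp Require Import all_boot all_order all_algebra.
From mathcomp Require Import all_classical all_reals all_analysis.
Import numFieldNormedType.Exports.
Import Order.TTheory GRing.Theory Num.Theory.

Set Implicit Arguments.
Unset Strict Implicit.
Unset Printing Implicit Defensive.

Local Open Scope classical_set_scope.
Local Open Scope ring_scope.

Definition step {R : realType} (t : R) : R := (t != 0)%:R.

Definition l0norm {R : realType} {n : nat} (x : 'rV[R]_n) : nat :=
  #|[pred i : 'I_n | x ord0 i != 0]|.

(* The library norms on ['rV_n] and on products are sup norms, hence an
   explicit Euclidean ball. *)
Definition euclid_ball0 {R : realType} {n m : nat} (eps : R) :
    set ('rV[R]_n * 'rV[R]_m) :=
  [set p : 'rV[R]_n * 'rV[R]_m |
     Num.sqrt (\sum_(i < n) p.1 ord0 i ^+ 2 +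
                \sum_(j < m) p.2 ord0 j ^+ 2) < eps].

Definition dc_function {R : realType} {E : lmodType R} (f : E -> R) : Prop :=
  exists g h : E -> R,
    [/\ convex_function [set: convex_lmodType E] g,
        convex_function [set: convex_lmodType E] h &
        forall p, f p = g p - h p].

Definition subdiff {R : realType} (phi : R -> R) (t : R) : set R :=
  [set u | forall s, phi t + u * (s - t) <= phi s].

Definition dc_subdiff {R : realType} (phi psi : R -> R) (t : R) : set R :=
  [set u - v | u in subdiff phi t & v in subdiff psi t].

(* Families are indexed by all of [R], but only positive parameters matter.
   The supremum is taken in the extended reals: the real-valued [sup] would be
   0 on an unbounded set. *)
Record admissible {R : realType} (r phi psi : R -> R -> R) : Prop := {
  adm_cvg : forall t, r theta t @[theta --> +oo] --> step t ;
  adm_even : forall theta, 0 < theta -> forall t, r theta t = r theta `|t| ;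
  adm_ndecr : forall theta, 0 < theta ->
    forall s t, 0 <= s -> s <= t -> r theta s <= r theta t ;
  adm_convexl : forall theta, 0 < theta ->
    convex_function [set: convex_lmodType R^o] (phi theta) ;
  adm_convexr : forall theta, 0 < theta ->
    convex_function [set: convex_lmodType R^o] (psi theta) ;
  adm_dc : forall theta, 0 < theta ->
    forall t, r theta t = phi theta t - psi theta t ;
  adm_sign : forall theta, 0 < theta ->
    forall t mu, dc_subdiff (phi theta) (psi theta) t mu -> 0 <= t * mu ;
  adm_vanish : forall a b, a <= b -> ~~ (a <= 0 <= b) ->
    ereal_sup [set `|z|%:E | z in
        \bigcup_(t in `[a, b]) dc_subdiff (phi theta) (psi theta) t]
      @[theta --> +oo] --> 0%:E
}.

Definition global_solutions {R : realType} {T : Type} (F : T -> R)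
    (K : set T) : set T :=
  [set p | K p /\ forall q, K q -> F p <= F q].

Definition l0_solutions {R : realType} {n m : nat} (lambda : R)
    (f : 'rV[R]_n * 'rV[R]_m -> R) (K : set ('rV[R]_n * 'rV[R]_m)) :
    set ('rV[R]_n * 'rV[R]_m) :=
  global_solutions (fun p => f p + lambda * (l0norm p.1)%:R) K.

Definition approx_solutions {R : realType} {n m : nat} (lambda : R)
    (f : 'rV[R]_n * 'rV[R]_m -> R) (rtheta : R -> R)
    (K : set ('rV[R]_n * 'rV[R]_m)) : set ('rV[R]_n * 'rV[R]_m) :=
  global_solutions
    (fun p => f p + lambda * \sum_(i < n) rtheta (p.1 ord0 i)) K.

(* Main.v *)
(* A finite convex function on a finite-dimensional space is continuous, so [f]
   is. Each [r theta] is even and nondecreasing on [0, +oo), so for [w] near [z]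
   the penalty at [w] dominates the penalty at the fixed vector [|z_i| / 2],
   which tends to [l0norm z]. Hence if [q] beats [z] in the limit problem, it
   beats every [w] near [z] in the approximate problem for all large [theta]:
   a point outside P has a neighbourhood that avoids all P_theta with [theta]
   large. This gives (i) directly, (ii) by covering the compact set [K], and
   (iii) by a finite intersection. *)
Require Import Defs.
From mathcomp Require Import all_boot all_order all_algebra.
From mathcomp Require Import all_classical all_reals all_analysis.
From mathcomp Require Import lra.
Import numFieldNormedType.Exports.
Import Order.TTheory GRing.Theory Num.Theory.

Set Implicit Arguments.
Unset Strict Implicit.
Unset Printing Implicit Defensive.

Local Open Scope classical_set_scope.
Local Open Scope ring_scope.

(** * Continuity of finite convex functions in finite dimension *)

Section ConvexContinuity.
Context {R : realType}.

Definition convex_ineq (E : lmodType R) (g : E -> R) : Prop :=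
  forall (t : R) (x y : E), 0 <= t <= 1 ->
    g (t *: x + (1 - t) *: y) <= t * g x + (1 - t) * g y.

Lemma convex_function_ineq (E : lmodType R) (g : E -> R) :
  convex_function [set: convex_lmodType E] g -> convex_ineq g.
Proof.
move=> gc t x y /andP[t0 t1].
(* [convex_function] takes its weight in an interval type, so the bounds on [t] are packed into an
   element of it. *)
have t01 : Itv.spec (@Itv.num_sem R) (Itv.Real `[0%Z, 1%Z]) t.
  by rewrite /Itv.spec/= /Itv.num_sem/= in_itv/= t0 t1 ger0_real.
by have := gc (Itv.mk t01) x y (in_setT _) (in_setT _).
Qed.

Lemma convex_ineq_mean (E : lmodType R) (g : E -> R) (x y : E) :
  convex_ineq g -> g (x + y) <= (g (2 *: x) + g (2 *: y)) / 2.
Proof.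
move=> gc; have h : 0 <= (2^-1 : R) <= 1 by lra.
have := gc 2^-1 (2 *: x) (2 *: y) h.
have -> : 1 - 2^-1 = 2^-1 :> R by lra.
by rewrite !scalerA mulVf ?pnatr_eq0// !scale1r -mulrDr mulrC.
Qed.

Lemma convex_ineq_translate (E : lmodType R) (g : E -> R) (a : E) (c : R) :
  convex_ineq g -> convex_ineq (fun v => g (a + v) - c).
Proof.
move=> gc t x y /(gc t (a + x) (a + y)).
rewrite !scalerDr addrACA -scalerDl addrC.
have -> : t + (1 - t) = 1 by lra.
rewrite scale1r addrC; lra.
Qed.

(** The point [c *: e] lies on the segment from 0 to [e] or to [- e], depending on the sign of [c].
    The bound is in [d] rather than [|c|] so that one [d] can serve all coordinates. *)
Lemma convex_ineq_line_ub (E : lmodType R) (g : E -> R) (e : E) :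
  convex_ineq g -> g 0 = 0 ->
  exists2 C : R, 0 <= C & forall c d : R, `|c| <= d -> d <= 1 ->
    g (c *: e) <= C * d.
Proof.
move=> gc g0; exists (`|g e| + `|g (- e)|); first by rewrite addr_ge0.
move=> c d cd d1.
suff [u [gu gE]] : exists u : E, g u <= `|g e| + `|g (- e)| /\
    c *: e = `|c| *: u.
  have c01 : 0 <= `|c| <= 1 by rewrite normr_ge0 (le_trans cd).
  have := gc _ u 0 c01.
  rewrite scaler0 addr0 -gE g0 mulr0 addr0 => /le_trans; apply.
  rewrite (le_trans (ler_wpM2l (normr_ge0 _) gu))// mulrC.
  by rewrite ler_wpM2l// addr_ge0.
have [c0|c0] := leP 0 c.
- by exists e; split; [rewrite ler_wpDr// ler_norm|rewrite ger0_norm].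
- exists (- e); split; first by rewrite ler_wpDl// ler_norm.
  by rewrite ltr0_norm// scaleNr scalerN opprK.
Qed.

(* Each step of the induction halves [delta]: the last term and the remaining sum
   are separated by [g (x + y) <= (g (2 x) + g (2 y)) / 2]. *)
Lemma convex_ineq_comb_ub (E : lmodType R) (g : E -> R) (k : nat)
    (e : 'I_k -> E) :
  convex_ineq g -> g 0 = 0 ->
  exists C delta : R, [/\ 0 <= C, 0 < delta &
    forall (d : R) (c : 'I_k -> R), d <= delta ->
      (forall i, `|c i| <= d) -> 0 <= d ->
      g (\sum_(i < k) c i *: e i) <= C * d].
Proof.
move=> gc g0; elim: k e => [|k IH] e.
  by exists 0, 1; split=> // d c _ _ _; rewrite big_ord0 g0 mul0r.
have [C1 [delta [C10 d0 H1]]] := IH (fun i => e (widen_ord (leqnSn k) i)).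
have [C2 C20 H2] := convex_ineq_line_ub (e ord_max) gc g0.
(* The mean of [C1 * (2 * d)] and [C2 * (2 * d)] is [(C1 + C2) * d]; the cap 1 keeps [2 * d] in the
   range of the bound on a line. *)
exists (C1 + C2), (Num.min delta 1 / 2); split.
- exact: addr_ge0.
- by rewrite divr_gt0// lt_min d0/=.
move=> d c dd cd d_ge0; rewrite big_ord_recr/=.
apply: (le_trans (convex_ineq_mean _ _ gc)).
have [ddelta d1] : 2 * d <= delta /\ 2 * d <= 1.
  by split; move: dd; case: (leP delta 1) => ?; lra.
have c2 i : `|2 * c i| <= 2 * d by rewrite normrM ger0_norm// ler_pM2l.
rewrite scaler_sumr scalerA.
under eq_bigr do rewrite scalerA.
have := H1 (2 * d) (fun i => 2 * c (widen_ord (leqnSn k) i)) ddelta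
  (fun i => c2 _) (mulr_ge0 _ d_ge0).
have := H2 _ _ (c2 ord_max) d1.
move=> /[swap] /(_ (ler0n _ 2)); lra.
Qed.

(** Near 0 all coordinates in the standard basis are small at once, so the bound on linear
    combinations applies. *)
Lemma convex_ineq_row_usc0 (n : nat) (g : 'rV[R]_n -> R) :
  convex_ineq g -> g 0 = 0 ->
  forall eps : R, 0 < eps -> \forall v \near (0 : 'rV[R]_n), g v <= eps.
Proof.
move=> gc g0 eps eps0.
have [C [delta [C0 d0 H]]] := convex_ineq_comb_ub (fun i : 'I_n => 'e_i) gc g0.
(* This gives [C * d <= eps]; the denominator [C + 1] stays positive when [C] is 0. *)
pose d := Num.min delta (eps / (C + 1)).
have C1 : 0 < C + 1 by rewrite ltr_wpDl.
have dgt0 : 0 < d by rewrite lt_min d0 divr_gt0.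
near=> v.
rewrite (row_sum_delta v).
apply: (@le_trans _ _ (C * d)).
  apply: H; [by rewrite ge_min lexx| |exact: ltW].
  near: v; apply: filter_forall => i.
  have : (fun v : 'rV[R]_n => v 0 i) @ (0 : 'rV[R]_n) --> (0 : R).
    have := @coord_continuous R 1 n 0 i (0 : 'rV[R]_n).
    by rewrite /continuous_at mxE.
  move=> /cvgr0_norm_le; exact.
have : d <= eps / (C + 1) by rewrite ge_min lexx orbT.
rewrite ler_pdivlMr// mulrDr mulr1 mulrC; lra.
Unshelve. all: by end_near. Qed.

Lemma convex_ineq_prod_usc0 (n m : nat) (g : 'rV[R]_n * 'rV[R]_m -> R) :
  convex_ineq g -> g 0 = 0 ->
  forall eps : R, 0 < eps ->
    \forall v \near (0 : 'rV[R]_n * 'rV[R]_m), g v <= eps.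
Proof.
move=> gc g0 eps eps0.
(* The factor 2 compensates for the midpoint inequality applied to [v = (v.1, 0) + (0, v.2)]. *)
pose gl := fun x : 'rV[R]_n => g (2 *: x, 0).
pose gr := fun y : 'rV[R]_m => g (0, 2 *: y).
have glc : convex_ineq gl.
  move=> t x y /(gc t (2 *: x, 0) (2 *: y, 0)); congr (_ <= _).
  rewrite /gl; congr g; congr pair => /=.
    by rewrite scalerDr !scalerA ![_ * 2]mulrC.
  by rewrite !scaler0 addr0.
have grc : convex_ineq gr.
  move=> t x y /(gc t (0, 2 *: x) (0, 2 *: y)); congr (_ <= _).
  rewrite /gr; congr g; congr pair => /=.
    by rewrite !scaler0 addr0.
  by rewrite scalerDr !scalerA ![_ * 2]mulrC.
have gl0 : gl 0 = 0 by rewrite /gl scaler0.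
have gr0 : gr 0 = 0 by rewrite /gr scaler0.
near=> v.
have -> : v = (v.1, 0) + (0, v.2).
  by rewrite [LHS]surjective_pairing; congr pair; rewrite /= ?addr0 ?add0r.
apply: (le_trans (convex_ineq_mean _ _ gc)).
have -> : g (2 *: (v.1, 0)) = gl v.1.
  by rewrite /gl; congr g; congr pair; rewrite /= scaler0.
have -> : g (2 *: (0, v.2)) = gr v.2.
  by rewrite /gr; congr g; congr pair; rewrite /= scaler0.
have : gl v.1 <= eps.
  by near: v; apply: (cvg_fst (convex_ineq_row_usc0 glc gl0 eps0)).
have : gr v.2 <= eps.
  by near: v; apply: (cvg_snd (convex_ineq_row_usc0 grc gr0 eps0)).
lra.
Unshelve. all: by end_near. Qed.

Lemma convex_ineq_continuous (n m : nat) (g : 'rV[R]_n * 'rV[R]_m -> R) :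
  convex_ineq g -> continuous g.
Proof.
move=> gc x.
pose h v := g (x + v) - g x.
have hc : convex_ineq h by exact: convex_ineq_translate.
have h0 : h 0 = 0 by rewrite /h addr0 subrr.
(* Upper semicontinuity at 0 suffices, since [h 0 = 0] is at most the mean of
   [h v] and [h (- v)]. *)
have hN v : - h (- v) <= h v.
  have := convex_ineq_mean (2^-1 *: v) (2^-1 *: (- v)) hc.
  rewrite !scalerA mulfV ?pnatr_eq0// !scale1r -scalerDr subrr scaler0 h0; lra.
apply/cvgrPdist_le => eps eps0.
have hu := convex_ineq_prod_usc0 hc h0 eps0.
near=> y.
have gE : h (y - x) = g y - g x by rewrite /h subrKC.
have h1 : h (y - x) <= eps.
  near: y.
  have : (fun y => y - x) @ x --> (0 : 'rV[R]_n * 'rV[R]_m).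
    rewrite -[X in _ --> X](subrr x).
    by apply: cvgB; [exact: cvg_id|exact: cvg_cst].
  by move/(_ _ hu).
have h2 : h (- (y - x)) <= eps.
  near: y.
  have : (fun y => - (y - x)) @ x --> (0 : 'rV[R]_n * 'rV[R]_m).
    rewrite -[X in _ --> X]oppr0 -(subrr x); apply: cvgN.
    by apply: cvgB; [exact: cvg_id|exact: cvg_cst].
  by move/(_ _ hu).
have := hN (y - x).
rewrite ler_norml; lra.
Unshelve. all: by end_near. Qed.

Lemma dc_function_continuous (n m : nat) (f : 'rV[R]_n * 'rV[R]_m -> R) :
  dc_function f -> continuous f.
Proof.
move=> [g [h [/convex_function_ineq gc /convex_function_ineq hc fE]]].
have -> : f = (fun p => g p - h p) by apply/funext.
by move=> x; apply: cvgB; exact: convex_ineq_continuous.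
Qed.

End ConvexContinuity.

(** * Excluding non-solutions of the limit problem for large [theta] *)

Section Approximation.
Context {R : realType}.

Lemma l0normE (n : nat) (x : 'rV[R]_n) :
  (l0norm x)%:R = \sum_(i < n) step (x ord0 i).
Proof.
rewrite /l0norm -sum1_card natr_sum big_mkcond/=.
by apply: eq_bigr => i _; rewrite inE /step; case: eqP.
Qed.

Lemma admissible_sum_cvg (r phi psi : R -> R -> R) (n : nat) (c : 'I_n -> R) :
  admissible r phi psi ->
  \sum_(i < n) r theta (c i) @[theta --> +oo] --> \sum_(i < n) step (c i).
Proof.
move=> ra; apply: cvg_big => [|i _]; first exact: add_continuous.
exact: adm_cvg ra (c i).
Qed.

Lemma sum_sqr_cvg0 (k : nat) :
  \sum_(i < k) x ord0 i ^+ 2 @[x --> (0 : 'rV[R]_k)] --> (0 : R).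
Proof.
have sum0 : \sum_(i < k) (0 : 'rV[R]_k) ord0 i * (0 : 'rV[R]_k) ord0 i = 0.
  by rewrite big1// => i _; rewrite mxE mulr0.
rewrite -[X in _ --> X]sum0.
apply: (@cvg_big _ _ +%R 0 xpredT) => [|i _]; first exact: add_continuous.
by apply: cvgM; exact: coord_continuous.
Qed.

Variables (n m : nat) (lambda : R) (K : set ('rV[R]_n * 'rV[R]_m)).
Variables (f : 'rV[R]_n * 'rV[R]_m -> R) (r phi psi : R -> R -> R).
Hypotheses (lambda_gt0 : 0 < lambda) (K_closed : closed K).
Hypotheses (f_cont : continuous f) (r_adm : admissible r phi psi).

(** The neighbourhood is joint in [w] and [theta]: this uniformity is what a moving sequence of
    solutions and a compact covering require. *)
Lemma near_not_approx_solution (z : 'rV[R]_n * 'rV[R]_m) :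
  ~ l0_solutions lambda f K z ->
  \forall w \near z & theta \near +oo,
    ~ approx_solutions lambda f (r theta) K w.
Proof.
move=> zP; have [Kz|nKz] := pselect (K z); last first.
  near=> w theta => -[Kw _]; apply: (_ : ~ K w) => //.
  by near: w; apply: open_nbhs_nbhs; split => //; exact: closed_openC.
have [q [Kq Fqz]] : exists q, K q /\
    f q + lambda * (l0norm q.1)%:R < f z + lambda * (l0norm z.1)%:R.
  apply/not_existsP => H; apply: zP; split=> // q Kq.
  by rewrite leNgt; apply/negP => Fq; apply: (H q).
(* Once the penalty at [w] dominates the one at [|z_i| / 2], [gap theta < f w] suffices for [q] to
   beat [w]. *)
pose gap theta := f q + lambda * (\sum_(i < n) r theta (q.1 ord0 i)
  - \sum_(i < n) r theta (`|z.1 ord0 i| / 2)).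
have gap_cvg : gap theta @[theta --> +oo] -->
    f q + lambda * ((l0norm q.1)%:R - (l0norm z.1)%:R).
  apply: cvgD; first exact: cvg_cst.
  apply: cvgM; first exact: cvg_cst.
  apply: cvgB; first by rewrite l0normE; exact: admissible_sum_cvg _ r_adm.
  have -> : (l0norm z.1)%:R = \sum_(i < n) step (`|z.1 ord0 i| / 2) :> R.
    rewrite l0normE; apply: eq_bigr => i _.
    by rewrite /step mulf_eq0 invr_eq0 pnatr_eq0 orbF normr_eq0.
  exact: admissible_sum_cvg _ r_adm.
(* The midpoint between the limit of [gap] and [f z] splits the comparison into a condition on
   [theta] alone and one on [w] alone. *)
pose c := (f z + (f q + lambda * ((l0norm q.1)%:R - (l0norm z.1)%:R))) / 2.
have [qc cz] : f q + lambda * ((l0norm q.1)%:R - (l0norm z.1)%:R) < c /\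
    c < f z.
  by rewrite /c mulrBr; split; lra.
near=> w theta => -[_ /(_ _ Kq)]; apply/negP; rewrite -ltNge.
have gapc : gap theta < c by near: theta; exact: (cvgr_lt _ gap_cvg).
have cw : c < f w by near: w; exact: (cvgr_gt (f z) (@f_cont z)).
have theta0 : 0 < theta by near: theta; exact: nbhs_pinfty_gt.
suff : \sum_(i < n) r theta (`|z.1 ord0 i| / 2)
    <= \sum_(i < n) r theta (w.1 ord0 i).
  move=> /(ler_wpM2l (ltW lambda_gt0)); move: gapc; rewrite /gap mulrBr; lra.
apply: ler_sum => i _; rewrite [leRHS](adm_even r_adm)//.
apply: (adm_ndecr r_adm) => //.
move: i; near: w; apply: filter_forall => i.
have zi_cvg : (fun w : 'rV[R]_n * 'rV[R]_m => `|w.1 ord0 i|) @ z -->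
    `|z.1 ord0 i|.
  apply: cvg_norm.
  pose coord (x : 'rV[R]_n) := x ord0 i.
  have cc : coord @ z.1 --> z.1 ord0 i by exact: coord_continuous.
  have cf : @fst 'rV[R]_n 'rV[R]_m @ z --> z.1 by exact: cvg_fst.
  exact: (cvg_comp _ coord cf cc).
(* If [z_i = 0] the bound reads [0 <= |w_i|]; otherwise [|z_i| / 2 < |z_i|] is strict and persists
   near [z]. *)
have [zi0|zi0] := eqVneq (z.1 ord0 i) 0.
  by near=> w; rewrite zi0 normr0 mul0r.
apply: (cvgr_ge _ zi_cvg).
by rewrite ltr_pdivrMr// ltr_pMr ?normr_gt0// ltr1n.
Unshelve. all: by end_near. Qed.

(** * Consequences for convergent sequences, compact sets and finite sets *)

Lemma approx_solutions_cvg (theta : nat -> R)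
    (z : nat -> 'rV[R]_n * 'rV[R]_m) (zstar : 'rV[R]_n * 'rV[R]_m) :
  theta k @[k --> \oo] --> +oo ->
  (forall k, approx_solutions lambda f (r (theta k)) K (z k)) ->
  z k @[k --> \oo] --> zstar ->
  l0_solutions lambda f K zstar.
Proof.
move=> thetaoo zP zcvg; apply: contrapT => /near_not_approx_solution zN.
have H : \forall k \near \oo, ~ approx_solutions lambda f (r (theta k)) K (z k).
  exact: (cvg_pair zcvg thetaoo zN).
by have /filter_ex[k] := H; apply.
Qed.

(** The ambient neighbourhoods come from sup norms; continuity of the Euclidean norm at 0 makes its
    balls neighbourhoods too. *)
Lemma euclid_ball0_near0 (eps : R) : 0 < eps ->
  \forall v \near (0 : 'rV[R]_n * 'rV[R]_m), euclid_ball0 eps v.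
Proof.
move=> eps0.
pose E := ('rV[R]_n * 'rV[R]_m)%type.
pose ss k (x : 'rV[R]_k) := \sum_(i < k) x ord0 i ^+ 2.
have ss1 : (fun v : E => ss n v.1) @ (0 : E) --> (0 : R).
  have h : @fst 'rV[R]_n 'rV[R]_m @ (0 : E) --> (0 : 'rV[R]_n).
    exact: cvg_fst.
  exact: (cvg_comp _ (ss n) h (@sum_sqr_cvg0 n)).
have ss2 : (fun v : E => ss m v.2) @ (0 : E) --> (0 : R).
  have h : @snd 'rV[R]_n 'rV[R]_m @ (0 : E) --> (0 : 'rV[R]_m).
    exact: cvg_snd.
  exact: (cvg_comp _ (ss m) h (@sum_sqr_cvg0 m)).
have := cvg_comp _ Num.sqrt (cvgD ss1 ss2) (@sqrt_continuous R (0 + 0)).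
by rewrite addr0 sqrtr0 => sqrt_cvg; exact: (cvgr_lt _ (sqrt_cvg _) _ eps0).
Qed.

Lemma approx_solutions_near (eps : R) : compact K -> 0 < eps ->
  \forall theta \near +oo, approx_solutions lambda f (r theta) K `<=`
    [set p + b | p in l0_solutions lambda f K & b in euclid_ball0 eps].
Proof.
move=> /compact_near_coveringP Kc eps0.
(* Being an approximate solution becomes a premise inside the set, so that the set to be covered is
   [K], independent of [theta]. *)
suff : \forall theta \near +oo, K `<=` [set w |
    approx_solutions lambda f (r theta) K w ->
    [set p + b | p in l0_solutions lambda f K & b in euclid_ball0 eps] w].
  by apply: filterS => theta H w wP; apply: H => //; case: wP.
apply: Kc => z Kz.
(* Near a solution [z], the point [z] itself is the required element of P; near any other [z] the
   premise fails for large [theta]. *)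
have [zP|/near_not_approx_solution] := pselect (l0_solutions lambda f K z).
  near=> w theta => _; exists z => //; exists (w - z); last by rewrite subrKC.
  near: w.
  have : (fun w => w - z) @ z --> (0 : 'rV[R]_n * 'rV[R]_m).
    rewrite -[X in _ --> X](subrr z).
    by apply: cvgB; [exact: cvg_id|exact: cvg_cst].
  by move/(_ _ (euclid_ball0_near0 eps0)).
by apply: filterS => -[w theta] /= nA /nA.
Unshelve. all: by end_near. Qed.

Lemma approx_solutions_finite (S : set ('rV[R]_n * 'rV[R]_m)) : finite_set S ->
  \forall theta \near +oo,
    approx_solutions lambda f (r theta) K `&` S `<=` l0_solutions lambda f K.
Proof.
move=> /finite_seqP[s ->].
have : \forall theta \near +oo, forall w, w \in s ->
    approx_solutions lambda f (r theta) K w -> l0_solutions lambda f K w.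
  elim: s => [|z s IH]; first by near=> theta.
  have zH : \forall theta \near +oo,
      approx_solutions lambda f (r theta) K z -> l0_solutions lambda f K z.
    have [zP|zN] := pselect (l0_solutions lambda f K z); first by near=> theta.
    have [[U V] /= [Uz Vt] UV] := near_not_approx_solution zN.
    apply: filterS Vt => theta Vtheta; apply: contraPP => _.
    (* Only the centre [z] of the neighbourhood [U] is used. *)
    by apply: (UV (z, theta)); split => //; exact: nbhs_singleton.
  near=> theta => w; rewrite inE => /orP[/eqP ->|]; first by near: theta.
  by move: w; near: theta.
by apply: filterS => theta H w [wP ws]; exact: H.
Unshelve. all: by end_near. Qed.

End Approximation.

Theorem theorem1 (R : realType) (n m : nat) (lambda : R)
    (K : set ('rV[R]_n * 'rV[R]_m)) (f : 'rV[R]_n * 'rV[R]_m -> R)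
    (r phi psi : R -> R -> R)
    (lambda_gt0 : 0 < lambda)
    (K_closed : closed K)
    (K_convex : convex_set (M := ('rV[R]_n * 'rV[R]_m)%type) K)
    (f_dc : dc_function f)
    (r_adm : admissible r phi psi) :
  [/\ (* (i) *)
      forall (theta : nat -> R) (z : nat -> 'rV[R]_n * 'rV[R]_m)
          (zstar : 'rV[R]_n * 'rV[R]_m),
        (forall k, 0 < theta k) ->
        theta k @[k --> \oo] --> +oo ->
        (forall k, approx_solutions lambda f (r (theta k)) K (z k)) ->
        z k @[k --> \oo] --> zstar ->
        l0_solutions lambda f K zstar,
      (* (ii) *)
      compact K ->
      forall eps : R, 0 < eps ->
        exists2 theta_eps : R, 0 < theta_eps &
          forall theta, theta_eps <= theta ->
            approx_solutions lambda f (r theta) K `<=`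
            [set p + b | p in l0_solutions lambda f K & b in euclid_ball0 eps] &
      (* (iii) *)
      forall S : set ('rV[R]_n * 'rV[R]_m),
        finite_set S ->
        (forall theta, 0 < theta ->
          approx_solutions lambda f (r theta) K `&` S !=set0) ->
        exists2 theta0 : R, 0 <= theta0 &
          forall theta, 0 < theta -> theta0 <= theta ->
            approx_solutions lambda f (r theta) K `&` S `<=`
            l0_solutions lambda f K].
Proof.
have f_cont := dc_function_continuous f_dc.
split.
- move=> theta z zstar _.
  exact: (approx_solutions_cvg lambda_gt0 K_closed f_cont r_adm).
- move=> K_compact eps eps0.
  have [M [_ HM]] :=
    approx_solutions_near lambda_gt0 K_closed f_cont r_adm K_compact eps0.
  (* The threshold [M] may be negative and is valid only for [theta > M]; [|M| + 1] is positive and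
     strictly above it. *)
  exists (`|M| + 1) => [|theta Mtheta]; first by rewrite ltr_wpDl.
  by apply: HM; rewrite (le_lt_trans (ler_norm M))//; lra.
- move=> S S_finite _.
  have [M [_ HM]] :=
    approx_solutions_finite lambda_gt0 K_closed f_cont r_adm S_finite.
  exists (`|M| + 1) => [|theta _ Mtheta]; first by rewrite addr_ge0.
  by apply: HM; rewrite (le_lt_trans (ler_norm M))//; lra.
Qed.
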